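(* Let $\alpha=\frac{3-\sqrt5}{2}\approx 0.382$ (the smaller root of $\alpha=(1-\alpha)^2$). There is a polynomial-time online contention resolution scheme (OCRS) for matchings that is $\alpha$-selectable in the vanishing regime; that is, there is a function $f$ with $\lim_{\varepsilon\to 0}f(\varepsilon)=0$ such that for every finite simple graph $G=(V,E)$, every fractional matching $\boldsymbol{x}=(x_e)_{e\in E}$ of $G$, and every arrival order of $E$ chosen by an oblivious adversary, the OCRS selects every edge $e\in E$ with probability at least $(\alpha-f(\max_{e'\in E}x_{e'}))\,x_e$.
   Context: A fractional matching of $G=(V,E)$ is a vector $\boldsymbol{x}\in[0,1]^E$ with $\sum_{e\in\partial(v)}x_e\le 1$ for all $v\in V$, where $\partial(v)$ is the set of edges incident to $v$. Each edge $e$ is independently active ($X_e=1$) with probability $x_e$ and inactive ($X_e=0$) otherwise. In the online setting, the OCRS knows $G$ and $\boldsymbol{x}$ in advance; the edges are revealed one by one in an order fixed in advance by an adversary who knows the description of the OCRS (but not its random choices nor the states); when an edge arrives its state $X_e$ is revealed and the OCRS must irrevocably decide whether to select it. It may select $e$ only if $e$ is active and neither endpoint of $e$ is incident to a previously selected edge, so the selected set is a matching of active edges. ''Selects every edge with probability at least $c\,x_e$'' is equivalent to $\Pr[e\text{ selected}\mid X_e=1]\ge c$. *)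

(* Defs.v *)
From mathcomp Require Import all_boot all_order all_algebra.

Set Implicit Arguments.
Unset Strict Implicit.
Unset Printing Implicit Defensive.

Import Order.TTheory GRing.Theory Num.Theory.
Local Open Scope ring_scope.

(** * Graphs and fractional matchings *)

(* A simple graph is a symmetric irreflexive relation; its edges are the
   unordered pairs [set u; v] with adj u v. *)
Definition edges (V : finType) (adj : rel V) : {set {set V}} :=
  [set e : {set V} | [exists u, exists v, adj u v && (e == [set u; v])]].

Definition fractional_matching (R : rcfType) (V : finType) (adj : rel V)
    (x : {set V} -> R) : Prop :=
  (forall e, e \in edges adj -> 0 <= x e <= 1) /\
  (forall v : V, \sum_(e in edges adj | v \in e) x e <= 1).

Definition max_weight (R : rcfType) (V : finType) (adj : rel V)
    (x : {set V} -> R) : R :=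
  \big[Num.max/0]_(e in edges adj) x e.

Definition arrival_order (V : finType) (adj : rel V) (order : seq {set V}) :
    Prop :=
  perm_eq order (enum (edges adj)).

Definition alpha (R : rcfType) : R := (3 - Num.sqrt 5) / 2.

(** * Finitely supported distributions, as lists of weighted outcomes *)

Definition dist (R : rcfType) (T : Type) := seq (R * T).

Definition dret (R : rcfType) (T : Type) (t : T) : dist R T := [:: (1, t)].

Definition dbind (R : rcfType) (T U : Type) (d : dist R T)
    (k : T -> dist R U) : dist R U :=
  [seq (p.1 * q.1, q.2) | p <- d, q <- k p.2].

Definition prob (R : rcfType) (T : Type) (d : dist R T) (Q : T -> bool) : R :=
  \sum_(p <- d | Q p.2) p.1.

(** * Randomized real RAM *)

(* Since x is a real vector, running time is counted in the real-RAM model: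
   exact real arithmetic (+, -, *, /, square root) and comparisons at unit
   cost, no rounding or floor, and no real constants other than naturals.  The
   integer part has only addition and truncated subtraction, so that integers
   stay below 2^(O(time)).  Memory is a fixed number of unbounded arrays, of
   naturals and of reals; a program names arrays statically and computes the
   indices. *)

Inductive nexp : Type :=
| NConst of nat
| NGet of nat & nexp            (* NGet a i : cell i of integer array a *)
| NAdd of nexp & nexp
| NSub of nexp & nexp.

Inductive rexp : Type :=
| RNat of nexp
| RGet of nat & nexp            (* RGet a i : cell i of real array a *)
| RAdd of rexp & rexp
| RSub of rexp & rexp
| RMul of rexp & rexp
| RDiv of rexp & rexp
| RSqrt of rexp.

Inductive bexp : Type :=
| BLeN of nexp & nexp
| BLeR of rexp & rexp
| BNot of bexp
| BAnd of bexp & bexp.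

Inductive cmd : Type :=
| Skip
| NSet of nat & nexp & nexp
| RSet of nat & nexp & rexp
| Flip of nat & nexp & rexp
| Seq of cmd & cmd
| If of bexp & cmd & cmd
| While of bexp & cmd.

Record state (R : rcfType) := State {
  nmem : nat -> nat -> nat;
  rmem : nat -> nat -> R }.

Definition upd (T : Type) (m : nat -> nat -> T) (a i : nat) (v : T) :
    nat -> nat -> T :=
  fun a' i' => if (a' == a) && (i' == i) then v else m a' i'.

Definition set_n (R : rcfType) (s : state R) (a i v : nat) : state R :=
  State (upd (nmem s) a i v) (rmem s).

Definition set_r (R : rcfType) (s : state R) (a i : nat) (v : R) : state R :=
  State (nmem s) (upd (rmem s) a i v).

Fixpoint neval (R : rcfType) (s : state R) (e : nexp) : nat :=
  match e with
  | NConst n => n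
  | NGet a i => nmem s a (neval s i)
  | NAdd e1 e2 => (neval s e1 + neval s e2)%N
  | NSub e1 e2 => (neval s e1 - neval s e2)%N
  end.

Fixpoint reval (R : rcfType) (s : state R) (e : rexp) : R :=
  match e with
  | RNat n => (neval s n)%:R
  | RGet a i => rmem s a (neval s i)
  | RAdd e1 e2 => reval s e1 + reval s e2
  | RSub e1 e2 => reval s e1 - reval s e2
  | RMul e1 e2 => reval s e1 * reval s e2
  | RDiv e1 e2 => reval s e1 / reval s e2
  | RSqrt e1 => Num.sqrt (reval s e1)
  end.

Fixpoint beval (R : rcfType) (s : state R) (b : bexp) : bool :=
  match b with
  | BLeN e1 e2 => (neval s e1 <= neval s e2)%N
  | BLeR e1 e2 => reval s e1 <= reval s e2
  | BNot b1 => ~~ beval s b1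
  | BAnd b1 b2 => beval s b1 && beval s b2
  end.

(* A configuration is the stack of commands still to be executed and the
   memory; the machine has halted when the stack is empty. *)
Definition config (R : rcfType) := (seq cmd * state R)%type.

(* Flip a i p writes to the integer cell a[i] the outcome of a fresh coin of
   bias p, truncated to [0, 1]: this is the test U <= p for a fresh U uniform
   in [0, 1]. *)
Definition step (R : rcfType) (g : config R) : dist R (config R) :=
  let: (k, s) := g in
  match k with
  | [::] => dret R ([::], s)
  | Skip :: k' => dret R (k', s)
  | NSet a i e :: k' => dret R (k', set_n s a (neval s i) (neval s e))
  | RSet a i e :: k' => dret R (k', set_r s a (neval s i) (reval s e))
  | Flip a i e :: k' =>
      let p := Num.min 1 (Num.max 0 (reval s e)) in
      [:: (p, (k', set_n s a (neval s i) 1));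
          (1 - p, (k', set_n s a (neval s i) 0))]
  | Seq c1 c2 :: k' => dret R ([:: c1, c2 & k'], s)
  | If b c1 c2 :: k' => dret R ((if beval s b then c1 else c2) :: k', s)
  | While b c :: k' =>
      dret R (if beval s b then [:: c, While b c & k'] else k', s)
  end.

Fixpoint steps (R : rcfType) (t : nat) (g : config R) : dist R (config R) :=
  if t is t'.+1 then dbind (step g) (@steps R t') else dret R g.

(** * Online contention resolution schemes *)

(* [ocrs_init] is run once on the graph and x, before any edge arrives;
   [ocrs_arrive] is run at each arrival.  The memory persists in between. *)
Record ocrs := OCRS { ocrs_init : cmd; ocrs_arrive : cmd }.

(* Edges are numbered by their position in enum (edges adj), vertices by
   enum_rank.  Interface with the program:
     integer array 0: cell 0 = |V|, cell 1 = |E|, cell 2 = number of the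
       arriving edge, cell 3 = its state, cell 4 = the decision of the program
       (select iff nonzero);
     integer arrays 1 and 2: the two endpoints of edge i, in cell i;
     real array 0: x_e in cell i, for the edge e number i.
   All other cells are initially 0. *)
Definition endpoint (V : finType) (e : {set V}) (j : nat) : nat :=
  nth 0%N [seq nat_of_ord (enum_rank v) | v <- enum e] j.

Definition input (R : rcfType) (V : finType) (adj : rel V)
    (x : {set V} -> R) : state R :=
  let E := enum (edges adj) in
  State
    (fun a i => match a, i with
                | 0, 0 => #|V|
                | 0, 1 => size E
                | 1, _ => nth 0 [seq endpoint e 0 | e <- E] i
                | 2, _ => nth 0 [seq endpoint e 1 | e <- E] i
                | _, _ => 0
                end%N)
    (fun a i => if a == 0%N then nth 0 [seq x e | e <- E] i else 0).

Definition reveal (R : rcfType) (V : finType) (adj : rel V) (e : {set V})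
    (active : bool) (s : state R) : state R :=
  set_n (set_n (set_n s 0 2 (index e (enum (edges adj)))) 0 3 active) 0 4 0.

(* The selected set, or None if the program exceeds its allowance of t steps
   during the initialization or at some arrival.  The set [act] of active edges
   is disclosed to the program only through the states of arrived edges. *)
Fixpoint serve (R : rcfType) (V : finType) (adj : rel V) (P : ocrs) (t : nat)
    (act : {set {set V}}) (order : seq {set V}) (s : state R)
    (sel : {set {set V}}) : dist R (option {set {set V}}) :=
  if order is e :: order' then
    dbind (steps t ([:: ocrs_arrive P], reveal adj e (e \in act) s)) (fun g =>
      if g.1 is [::] then
        serve adj P t act order' g.2
          (if nmem g.2 0 4 == 0%N then sel else e |: sel)
      else dret R None)
  else dret R (Some sel).

Definition run (R : rcfType) (V : finType) (adj : rel V) (x : {set V} -> R)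
    (P : ocrs) (t : nat) (act : {set {set V}}) (order : seq {set V}) :
    dist R (option {set {set V}}) :=
  dbind (steps t ([:: ocrs_init P], input adj x)) (fun g =>
    if g.1 is [::] then serve adj P t act order g.2 set0 else dret R None).

Definition matching_of_active (V : finType) (act : {set {set V}})
    (o : option {set {set V}}) : bool :=
  if o is Some M then (M \subset act) && trivIset M else false.

Definition selects (V : finType) (e : {set V}) (o : option {set {set V}}) :
    bool :=
  if o is Some M then e \in M else false.

Definition active_prob (R : rcfType) (V : finType) (adj : rel V)
    (x : {set V} -> R) (act : {set {set V}}) : R :=
  \prod_(e in edges adj) (if e \in act then x e else 1 - x e).

Definition select_prob (R : rcfType) (V : finType) (adj : rel V)
    (x : {set V} -> R) (P : ocrs) (t : nat) (order : seq {set V})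
    (e : {set V}) : R :=
  \sum_(act in powerset (edges adj))
    active_prob adj x act * prob (run adj x P t act order) (selects e).

(* Main.v *)
Require Import Defs.
From mathcomp Require Import all_boot all_order all_algebra.
From mathcomp Require Import reals topology normedtype.
From mathcomp Require Import sequences exp realfun.
From mathcomp Require Import ring lra.

(** For every vertex v keep F(v), the product of 1 - P(e) over the arrived edges
e at v, where P(e) is the probability, given the past, that e was going to be
selected. When e = {u, v} arrives active with both endpoints free, it is
selected with probability min(1, alpha / (F(u) F(v))), so that
P(e) = x_e min(1, alpha / (F(u) F(v))) if both endpoints are free, else 0.

Then M_v = [v free] / F(v) is a martingale, and so is M_u M_v until the edge
{u, v} arrives; thus E[M_u M_v] = 1 at that time, and e is selected with
probability x_e E[M_u M_v min(F(u) F(v), alpha)], which is close to alpha x_e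
as soon as F(u) F(v) >= alpha with small error. As F(v) P(e) <= alpha x_e M_u,
one has F(v) >= 1 - alpha sum_e x_e M_u over the arrived edges e = {u, v}, hence
F(v) >= 1 - alpha - alpha D(v) with D(v) = sum_e x_e (M_u - 1). The M_u are
almost uncorrelated, so E[D(v)^2] = O(max x): up to O(sqrt (max x)) in mean,
F(u) F(v) >= (1 - alpha)^2 = alpha. *)

Set Implicit Arguments.
Unset Strict Implicit.
Unset Printing Implicit Defensive.

Import Order.TTheory GRing.Theory Num.Theory.
Import numFieldNormedType.Exports.
Local Open Scope classical_set_scope.
Local Open Scope ring_scope.

(** * Expectations over machine runs and symbolic execution *)

Section Expectation.

Variable R : rcfType.

Definition expect (T : Type) (d : dist R T) (phi : T -> R) : R :=
  \sum_(p <- d) p.1 * phi p.2.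

Lemma expect_dret (T : Type) (t : T) (phi : T -> R) :
  expect (dret R t) phi = phi t.
Proof. by rewrite /expect big_seq1 mul1r. Qed.

Lemma expect_dbind (T U : Type) (d : dist R T) (k : T -> dist R U)
    (phi : U -> R) :
  expect (dbind d k) phi = expect d (fun t => expect (k t) phi).
Proof.
rewrite /expect /dbind big_allpairs_dep; apply: eq_bigr => p _ /=.
by rewrite mulr_sumr; apply: eq_bigr => q _; rewrite mulrA.
Qed.

Lemma prob_expect (T : Type) (d : dist R T) (Q : T -> bool) :
  prob d Q = expect d (fun t => (Q t)%:R).
Proof.
rewrite /prob /expect big_mkcond; apply: eq_bigr => p _ /=.
by case: (Q _); rewrite ?mulr1 ?mulr0.
Qed.

(** The rules below execute a program symbolically: each spends one unit of fuel, and a halted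
    configuration absorbs the fuel that is left. *)
Definition wp (t : nat) (g : config R) (phi : config R -> R) : R :=
  expect (steps t g) phi.

Arguments wp : simpl never.

Lemma wpS t g phi : wp t.+1 g phi = expect (step g) (fun g' => wp t g' phi).
Proof. exact: expect_dbind. Qed.

Lemma wp_nil t s phi : wp t ([::], s) phi = phi ([::], s).
Proof.
by elim: t => [|t IH]; [exact: expect_dret | rewrite wpS expect_dret].
Qed.

Lemma wp_Skip t k s phi : wp t.+1 (Skip :: k, s) phi = wp t (k, s) phi.
Proof. by rewrite wpS expect_dret. Qed.

Lemma wp_NSet t a i e k s phi :
  wp t.+1 (NSet a i e :: k, s) phi =
  wp t (k, set_n s a (neval s i) (neval s e)) phi.
Proof. by rewrite wpS expect_dret. Qed.

Lemma wp_RSet t a i e k s phi :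
  wp t.+1 (RSet a i e :: k, s) phi =
  wp t (k, set_r s a (neval s i) (reval s e)) phi.
Proof. by rewrite wpS expect_dret. Qed.

Lemma wp_Seq t c1 c2 k s phi :
  wp t.+1 (Seq c1 c2 :: k, s) phi = wp t ([:: c1, c2 & k], s) phi.
Proof. by rewrite wpS expect_dret. Qed.

Lemma wp_If t b c1 c2 k s phi :
  wp t.+1 (If b c1 c2 :: k, s) phi =
  wp t ((if beval s b then c1 else c2) :: k, s) phi.
Proof. by rewrite wpS expect_dret. Qed.

Definition clamp (r : R) : R := Num.min 1 (Num.max 0 r).

Lemma clamp_bounds r : 0 <= clamp r <= 1.
Proof. by rewrite /clamp ge_min lexx le_min ler01 le_max lexx. Qed.

Lemma clamp_id r : 0 <= r <= 1 -> clamp r = r.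
Proof. by case/andP=> r0 r1; rewrite /clamp max_r // min_r. Qed.

Lemma wp_Flip t a i e k s phi :
  wp t.+1 (Flip a i e :: k, s) phi =
  clamp (reval s e) * wp t (k, set_n s a (neval s i) 1) phi +
  (1 - clamp (reval s e)) * wp t (k, set_n s a (neval s i) 0) phi.
Proof. by rewrite wpS /expect /= big_cons big_seq1. Qed.

End Expectation.

(** * The program *)

Section Program.

Definition NAt (a i : nat) : nexp := NGet a (NConst i).
Definition arrived : nexp := NAt 0 2.
Definition end1 : nexp := NGet 1 arrived.
Definition end2 : nexp := NGet 2 arrived.
Definition RConst (n : nat) : rexp := RNat (NConst n).
Definition alpha_exp : rexp :=
  RDiv (RSub (RConst 3) (RSqrt (RConst 5))) (RConst 2).
(* Real array 1 stores 1 - F(v), so that F = 1 initially. *)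
Definition survival (w : nexp) : rexp := RSub (RConst 1) (RGet 1 w).
Definition acceptance : rexp := RGet 2 (NConst 0).
Definition is_free (w : nexp) : bexp := BLeN (NGet 3 w) (NConst 0).

(** [Flip] truncates its bias by itself, but [decay] multiplies by the same number, which therefore
    has to be clamped in memory. *)
Definition clamp_acceptance : cmd :=
  Seq (If (BLeR (RConst 1) acceptance) (RSet 2 (NConst 0) (RConst 1)) Skip)
      (If (BLeR acceptance (RConst 0)) (RSet 2 (NConst 0) (RConst 0)) Skip).

Definition decay (w : nexp) : cmd :=
  RSet 1 w (RSub (RConst 1) (RMul (survival w)
    (RSub (RConst 1) (RMul (RGet 0 arrived) acceptance)))).

Definition decide : cmd :=
  Seq (If (BLeN (NConst 1) (NAt 0 3)) (Flip 0 (NConst 4) acceptance) Skip)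
      (If (BLeN (NConst 1) (NAt 0 4))
          (Seq (NSet 3 end1 (NConst 1)) (NSet 3 end2 (NConst 1))) Skip).

Definition ratio : rexp :=
  RDiv alpha_exp (RMul (survival end1) (survival end2)).

(** The decays precede the coin and ignore the state of the edge, since P(e) is a probability given
    the past only. *)
Definition treat : cmd :=
  Seq (RSet 2 (NConst 0) ratio)
  (Seq clamp_acceptance (Seq (decay end1) (Seq (decay end2) decide))).

(** If an endpoint is taken then P(e) = 0, so skipping the edge leaves F correct. *)
Definition arrive : cmd :=
  If (BAnd (is_free end1) (is_free end2)) treat Skip.

(** The zeroed memory already encodes F = 1 and an empty matching, hence the initialization
    [Skip]. *)
Definition scheme : ocrs := OCRS Skip arrive.

End Program.

(** * Correctness of the program and reduction to an idealised process *)

Section Simulation.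

Variable R : rcfType.
Implicit Types s : state R.

(** Every branch takes exactly five steps, so one fuel count serves all cases. *)
Lemma wp_clamp_acceptance s :
  exists s', [/\ nmem s' = nmem s, rmem s' 2%N 0%N = clamp (rmem s 2%N 0%N),
    forall a i, a != 2%N -> rmem s' a i = rmem s a i &
    forall t k phi, wp t.+4.+1 (clamp_acceptance :: k, s) phi = wp t (k, s') phi].
Proof.
set r := rmem s 2%N 0%N.
have [r1|r1] := leP 1 r.
  exists (set_r s 2%N 0%N 1); split => //=.
  - by rewrite /upd /= /clamp max_r ?min_l //; apply: le_trans r1.
  - by move=> a i /negbTE; rewrite /upd => ->.
  - move=> t k phi; rewrite wp_Seq wp_If /= -/r r1 wp_RSet wp_If /=.
    by rewrite /upd /= ler10 wp_Skip.
have [r0|r0] := leP r 0.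
  exists (set_r s 2%N 0%N 0); split => //=.
  - by rewrite /upd /= /clamp max_l // min_r.
  - by move=> a i /negbTE; rewrite /upd => ->.
  - by move=> t k phi; rewrite wp_Seq wp_If /= -/r leNgt r1 wp_Skip wp_If /=
      -/r r0 wp_RSet.
exists s; split => //; first by rewrite clamp_id // !ltW.
move=> t k phi; rewrite wp_Seq wp_If /= -/r leNgt r1 wp_Skip wp_If /= -/r.
by rewrite leNgt r0 wp_Skip.
Qed.

Variables (V : finType) (adj : rel V) (x : {set V} -> R).
Hypothesis adj_irr : irreflexive adj.

Lemma edgeP e : e \in edges adj -> exists u v, u != v /\ e = [set u; v].
Proof.
rewrite inE => /existsP[u /existsP[v /andP[uv /eqP->]]]; exists u, v; split=> //.
by apply: contraTneq uv => ->; rewrite adj_irr.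
Qed.

Lemma edge_endpoints e : e \in edges adj ->
  exists u v, [/\ u != v, e = [set u; v],
    endpoint e 0 = enum_rank u & endpoint e 1 = enum_rank v].
Proof.
move=> /edgeP[u [v [uv eE]]].
have := enum_uniq (mem e); have : size (enum e) = 2 by rewrite -cardE eE cards2 uv.
have := mem_enum e; rewrite /endpoint.
case: (enum e) => [|a [|b []]] //= mem_ab _; rewrite inE andbT => ab.
by exists a, b; split=> //; apply/setP=> w; rewrite -mem_ab !inE.
Qed.

Definition accept (F : V -> R) (e : {set V}) : R :=
  clamp (alpha R / \prod_(v in e) F v).

Definition available (sel : {set {set V}}) (e : {set V}) : bool :=
  [disjoint e & cover sel].

Definition rate (sel : {set {set V}}) (F : V -> R) (e : {set V}) : R :=
  if available sel e then x e * accept F e else 0.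

Definition decayed (r : R) (e : {set V}) (F : V -> R) (v : V) : R :=
  if v \in e then F v * (1 - r) else F v.

(** The invariant between arrivals. Real array 2 and cells 2 to 4 of integer array 0 are left free:
    they are overwritten before being read. *)
Definition represents (s : state R) (sel : {set {set V}}) (F : V -> R) : Prop :=
  [/\ nmem s 1%N =1 nmem (input adj x) 1%N,
      nmem s 2%N =1 nmem (input adj x) 2%N,
      rmem s 0%N =1 rmem (input adj x) 0%N,
      forall v : V, nmem s 3%N (enum_rank v) = (v \in cover sel) &
      forall v : V, rmem s 1%N (enum_rank v) = 1 - F v].

Lemma represents_input : represents (input adj x) set0 (fun=> 1).
Proof.
split=> //= v; last by rewrite subrr.
by rewrite /cover big_set0 inE.
Qed.

Lemma represents_ext s sel F F' :
  F =1 F' -> represents s sel F -> represents s sel F'.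
Proof. by move=> FF' [? ? ? ? h]; split=> // v; rewrite -FF'. Qed.

Lemma cover_setU1 (e : {set V}) sel : cover (e |: sel) = e :|: cover sel.
Proof. by rewrite /cover bigcup_setU big_set1. Qed.

(** At most one coin is flipped, so two final memories suffice; both hold the same F' because the
    decays come first. Unless the edge is available and active, [s1] has weight 0 and nothing is
    claimed about it. *)
Lemma wp_arrive s sel F e b : represents s sel F -> e \in edges adj ->
  let q := if available sel e && b then accept F e else 0 in
  let F' := decayed (rate sel F e) e F in
  exists s1 s0, [/\
    forall phi, wp 40 ([:: arrive], reveal adj e b s) phi =
      q * phi ([::], s1) + (1 - q) * phi ([::], s0),
    available sel e && b ->
      represents s1 (e |: sel) F' /\ nmem s1 0%N 4%N = 1%N,
    represents s0 sel F' & nmem s0 0%N 4%N = 0%N].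
Proof.
move=> [s1E s2E x0E freeE FE] eE q F'.
have [u [v [uv euv end1E end2E]]] := edge_endpoints eE.
have ilt : (index e (enum (edges adj)) < size (enum (edges adj)))%N.
  by rewrite index_mem mem_enum.
set i := index e (enum (edges adj)) in ilt.
have s1i : nmem s 1%N i = enum_rank u.
  by rewrite s1E /= (nth_map e) // nth_index ?mem_enum.
have s2i : nmem s 2%N i = enum_rank v.
  by rewrite s2E /= (nth_map e) // nth_index ?mem_enum.
have xi : rmem s 0%N i = x e.
  by rewrite x0E /= (nth_map e) // nth_index ?mem_enum.
have rk_eq (a c : V) : (nat_of_ord (enum_rank a) == enum_rank c) = (a == c).
  by rewrite -(inj_eq enum_rank_inj).
have availE : available sel e = (u \notin cover sel) && (v \notin cover sel).
  by rewrite /available euv disjoints_subset subUset !sub1set !inE.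
have prodE : \prod_(w in e) F w = F u * F v.
  by rewrite euv big_setU1 ?inE //= big_set1.
set s' := reveal adj e b s.
have nm a j : a != 0%N -> nmem s' a j = nmem s a j.
  by rewrite /s' /reveal /= /upd => /negbTE->.
have guard : beval s' (BAnd (is_free end1) (is_free end2)) = available sel e.
  rewrite availE /= /upd /= -/i s1i s2i !freeE.
  by case: (u \in _); case: (v \in _).
have {}guard phi : wp 40 ([:: arrive], s') phi =
    wp 39 ([:: if available sel e then treat else Skip], s') phi.
  by rewrite wp_If guard.
have [av|nav] := boolP (available sel e); last first.
  have F'E : F =1 F'.
    by move=> w; rewrite /F' /decayed /rate (negbTE nav) subr0 mulr1 if_same.
  exists s', s'; split=> //; last exact: represents_ext F'E _.
  by move=> phi; rewrite guard /q (negbTE nav) /= wp_Skip wp_nil; ring.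
rewrite av in guard.
set sa := set_r s' 2%N 0%N (alpha R / (F u * F v)).
have [sb [nsb qsb rsb Wb]] := wp_clamp_acceptance sa.
have {}qsb : rmem sb 2%N 0%N = accept F e by rewrite qsb /accept prodE.
have {}rsb a j : a != 2%N -> rmem sb a j = rmem s a j.
  by move=> a2; rewrite rsb //= /upd (negbTE a2).
have {}nsb : nmem sb = nmem s' by rewrite nsb.
have idx (sx : state R) : nmem sx = nmem s' ->
    (neval sx end1 = enum_rank u) * (neval sx end2 = enum_rank v) *
    (neval sx arrived = i).
  by move=> nsx; rewrite /= nsx /= /upd /= -/i s1i s2i.
have rateE : rate sel F e = x e * accept F e by rewrite /rate av.
have reval_ratio : reval s' ratio = alpha R / (F u * F v).
  rewrite -[LHS]/(alpha R / ((1 - rmem s' 1%N (neval s' end1)) *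
                            (1 - rmem s' 1%N (neval s' end2)))).
  by rewrite !idx //= !FE !subKr.
have decayE sx w W : nmem sx = nmem s' -> neval sx w = enum_rank W ->
    rmem sx 1%N (enum_rank W) = 1 - F W -> rmem sx 0%N i = x e ->
    rmem sx 2%N 0%N = accept F e -> W \in e -> forall t k phi,
    wp t.+1 (decay w :: k, sx) phi =
    wp t (k, set_r sx 1%N (enum_rank W) (1 - F' W)) phi.
  move=> nsx wE FW xW qW We t k phi; rewrite wp_RSet wE; congr wp.
  congr (_, set_r _ _ _ _).
  rewrite -[LHS]/(1 - (1 - rmem sx 1%N (neval sx w)) *
    (1 - rmem sx 0%N (neval sx arrived) * rmem sx 2%N 0%N)).
  by rewrite wE !idx // xW qW FW subKr /F' /decayed We rateE.
have ue : u \in e by rewrite euv !inE eqxx.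
have ve : v \in e by rewrite euv !inE eqxx orbT.
set sc := set_r sb 1%N (enum_rank u) (1 - F' u).
set sd := set_r sc 1%N (enum_rank v) (1 - F' v).
have Wc t k phi : wp t.+1 (decay end1 :: k, sb) phi = wp t (k, sc) phi.
  by apply: decayE; rewrite ?qsb ?idx ?rsb.
have Wd t k phi : wp t.+1 (decay end2 :: k, sc) phi = wp t (k, sd) phi.
  apply: decayE; rewrite ?idx //= /upd /= ?rk_eq ?(eq_sym v) ?(negbTE uv) /=.
  - by rewrite rsb.
  - by rewrite rsb.
(* Fifteen steps lead to the coin; the other 25 are more than enough to finish. *)
have {}Wd phi : wp 40 ([:: arrive], s') phi =
    wp 25 ([:: if b then Flip 0 (NConst 4) acceptance else Skip;
      If (BLeN (NConst 1) (NAt 0 4))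
          (Seq (NSet 3 end1 (NConst 1)) (NSet 3 end2 (NConst 1))) Skip], sd) phi.
  rewrite guard wp_Seq wp_RSet reval_ratio wp_Seq Wb wp_Seq Wc wp_Seq Wd.
  by rewrite wp_Seq wp_If /= nsb /upd /= lt0b.
have Gd w : rmem sd 1%N (enum_rank w) = 1 - F' w.
  rewrite /= /upd /= !rk_eq; case: eqVneq => [->//|wv].
  case: eqVneq => [->//|wu]; rewrite rsb // FE /F' /decayed.
  by rewrite euv !inE (negbTE wu) (negbTE wv).
have rep_sd (sx : state R) : (forall a w, a != 0%N -> nmem sx a w = nmem s a w) ->
    rmem sx = rmem sd -> represents sx sel F'.
  move=> nsx rsx; split=> w; rewrite ?nsx ?rsx //.
  by rewrite /= /upd /= rsb.
have nsd a w : a != 0%N -> nmem sd a w = nmem s a w by move=> a0; rewrite nsb nm.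
have nsd4 j a w : a != 0%N -> nmem (set_n sd 0%N 4%N j) a w = nmem s a w.
  by move=> a0; rewrite /= /upd (negbTE a0) nsd.
pose s1 := set_n (set_n (set_n sd 0%N 4%N 1%N) 3%N (enum_rank u) 1%N)
  3%N (enum_rank v) 1%N.
exists s1, (if b then set_n sd 0%N 4%N 0%N else sd); split; last 3 first.
- move=> _; split=> //.
  have [|//|h1 h2 h3 h4 h5] := rep_sd (set_n sd 0%N 4%N 1%N); first exact: nsd4.
  split=> // w.
  rewrite /= /upd /= !rk_eq cover_setU1 euv !inE.
  by case: (eqVneq w v) => [->|_]; rewrite ?orbT //; case: (eqVneq w u) => [//|_];
    exact: h4.
- by case: (b); apply: rep_sd => // a w a0; rewrite ?nsd4 ?nsd.
- by case: (b) => //=; rewrite nsb.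
have finish1 t phi : wp t.+4 ([:: If (BLeN (NConst 1) (NAt 0 4))
    (Seq (NSet 3 end1 (NConst 1)) (NSet 3 end2 (NConst 1))) Skip],
    set_n sd 0%N 4%N 1%N) phi = phi ([::], s1).
  rewrite wp_If /= wp_Seq wp_NSet wp_NSet wp_nil; congr (phi (_, _)).
  by rewrite /s1 /= nsb /s' /= /upd /= -/i s1i s2i.
have qsd : reval sd acceptance = accept F e by rewrite /= /upd /= qsb.
move=> phi; rewrite Wd /q av; case: (b); rewrite [_ && _]/=.
  rewrite wp_Flip finish1 qsd wp_If /= wp_Skip wp_nil.
  by rewrite clamp_id // clamp_bounds.
rewrite wp_Skip wp_If /= nsb /= wp_Skip wp_nil; ring.
Qed.
Lemma trivIset_setU1 (e : {set V}) (sel : {set {set V}}) :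
  trivIset sel -> available sel e -> trivIset (e |: sel).
Proof.
move=> /trivIsetP tsel av; apply/trivIsetP => A B.
have disj C : C \in sel -> [disjoint e & C].
  by move=> Csel; apply: disjointWr av; apply: bigcup_sup Csel.
rewrite !inE => /predU1P[->|Asel] /predU1P[->|Bsel] AB; last exact: tsel.
- by rewrite eqxx in AB.
- exact: disj.
- by rewrite disjoint_sym disj.
Qed.

Lemma serve_cons (act : {set {set V}}) e o s sel phi :
  expect (serve adj scheme 40 act (e :: o) s sel) phi =
  wp 40 ([:: arrive], reveal adj e (e \in act) s) (fun g => expect
    (if g.1 is [::] then
        serve adj scheme 40 act o g.2
          (if nmem g.2 0 4 == 0%N then sel else e |: sel)
      else dret R None) phi).
Proof. exact: expect_dbind. Qed.

(** Both outcomes of [wp_arrive] have an empty stack, so the allowance of 40 steps is never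
    exceeded; the weights q and 1 - q then add up to 1. *)
Lemma serve_matching (act : {set {set V}}) (o : seq {set V}) s sel F :
  represents s sel F ->
  {subset o <= edges adj} -> sel \subset act -> trivIset sel ->
  prob (serve adj scheme 40 act o s sel) (matching_of_active act) = 1.
Proof.
rewrite prob_expect; elim: o s sel F => [|e o IH] s sel F rep osub selact tsel.
  by rewrite expect_dret /= selact tsel.
rewrite serve_cons.
have eE : e \in edges adj by apply: osub; rewrite inE eqxx.
have {}osub : {subset o <= edges adj}.
  by move=> f fo; apply: osub; rewrite inE fo orbT.
have [s1 [s0 [-> sim1 rep0 dec0]]] := wp_arrive (e \in act) rep eE.
rewrite /= dec0 eqxx (IH s0 _ _ rep0) // mulr1.
case: ifP => [avact|_]; last by rewrite mul0r add0r subr0.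
have [rep1 ->] := sim1 avact; have [av eact] := andP avact.
rewrite /= (IH s1 _ _ rep1) ?trivIset_setU1 ?subUset ?sub1set ?eact //; ring.
Qed.

Lemma run_scheme (act : {set {set V}}) order phi :
  expect (run adj x scheme 40 act order) phi =
  expect (serve adj scheme 40 act order (input adj x) set0) phi.
Proof. by rewrite expect_dbind -/(wp _ _ _) /= wp_Skip wp_nil. Qed.

Lemma run_matching (act : {set {set V}}) (order : seq {set V}) :
  {subset order <= edges adj} ->
  prob (run adj x scheme 40 act order) (matching_of_active act) = 1.
Proof.
move=> osub; rewrite prob_expect run_scheme -prob_expect.
apply: (serve_matching represents_input osub); first exact: sub0set.
by apply/trivIsetP=> A B; rewrite inE.
Qed.

(** [surv] is F, and [drift] is D, which serves the analysis only and is not stored by the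
    program. *)
Record pstate := PState {
  chosen : {set {set V}};
  surv : V -> R;
  drift : V -> R }.

Implicit Types (a : pstate) (phi psi : pstate -> R) (o : seq {set V}).

(** This is the martingale M_v. *)
Definition dens a (v : V) : R :=
  if v \in cover (chosen a) then 0 else (surv a v)^-1.

Definition prate a e : R := rate (chosen a) (surv a) e.

(* For an edge e = {v, w} the product over e :\ v is the single factor
   dens a w. *)
Definition pnext a (e : {set V}) (b : bool) : pstate :=
  PState (if b then e |: chosen a else chosen a)
    (decayed (prate a e) e (surv a))
    (fun v => if v \in e
              then drift a v + x e * (\prod_(w in e :\ v) dens a w - 1)
              else drift a v).

Definition pstart : pstate := PState set0 (fun=> 1) (fun=> 0).

Definition pstep (e : {set V}) phi a : R :=
  prate a e * phi (pnext a e true) + (1 - prate a e) * phi (pnext a e false).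

(** The process is an operator on test functions, so no probability space is built. The state of an
    edge and the coin are merged into one choice of probability [prate]. *)
Fixpoint pexp o phi a : R :=
  if o is e :: o' then pstep e (pexp o' phi) a else phi a.

Lemma eq_pexp o phi psi : phi =1 psi -> pexp o phi =1 pexp o psi.
Proof.
move=> phipsi; elim: o => [|e o IH] a //=.
by rewrite /pstep !IH.
Qed.

Lemma pexp_cat o1 o2 phi a : pexp (o1 ++ o2) phi a = pexp o1 (pexp o2 phi) a.
Proof. by elim: o1 a => [|e o1 IH] a //=; rewrite /pstep !IH. Qed.

Lemma pexp_rcons o e phi a : pexp (rcons o e) phi a = pexp o (pstep e phi) a.
Proof. by rewrite -cats1 pexp_cat. Qed.

Lemma sum_powerset_setU1 (T : finType) (e : T) (A : {set T})
    (f : {set T} -> R) : e \notin A ->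
  \sum_(B in powerset (e |: A)) f B =
  \sum_(B in powerset A) f (e |: B) + \sum_(B in powerset A) f B.
Proof.
move=> eA; rewrite (bigID (fun B : {set T} => e \in B)) /=; congr (_ + _).
  rewrite (reindex_onto (fun B => e |: B) (fun B => B :\ e)) /=; last first.
    by move=> B /andP[_ eB]; rewrite setD1K.
  apply: eq_bigl => B; rewrite !inE eqxx andbT subUset sub1set !inE eqxx /=.
  apply/andP/idP => [[BA /eqP eBE]|BA].
    have eB : e \notin B by rewrite -eBE !inE eqxx.
    by rewrite -(setU1K eA) subsetD1 BA.
  split; first exact: subset_trans BA (subsetUr _ _).
  by apply/eqP/setU1K; apply: contra eA => /(subsetP BA).
apply: eq_bigl => B; rewrite !inE.
apply/andP/idP => [[BA eB]|BA].
  by rewrite -(setU1K eA) subsetD1 BA.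
split; first exact: subset_trans BA (subsetUr _ _).
by apply: contra eA => /(subsetP BA).
Qed.

(** The program sees [act] only through the states of arriving edges; this lets an edge be dropped
    from [act] once it has been served. *)
Lemma eq_serve (act act' : {set {set V}}) o s sel
    (phi : option {set {set V}} -> R) : {in o, act =i act'} ->
  expect (serve adj scheme 40 act o s sel) phi =
  expect (serve adj scheme 40 act' o s sel) phi.
Proof.
elim: o s sel => [|e o IH] s sel eq_act //.
rewrite !serve_cons eq_act ?inE ?eqxx //; apply: eq_bigr => -[p [[|c k] s']] _ //=.
by congr (_ * _); apply: IH => f fo; rewrite eq_act // inE fo orbT.
Qed.

(** Deferred decisions: as the states are independent and nothing before the arrival of an edge
    depends on its state, that state may be drawn at the arrival. *)
Lemma expect_serve o s a (phi : option {set {set V}} -> R) :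
    represents s (chosen a) (surv a) -> uniq o -> {subset o <= edges adj} ->
  \sum_(act in powerset [set e in o])
    (\prod_(e in [set e in o]) (if e \in act then x e else 1 - x e)) *
    expect (serve adj scheme 40 act o s (chosen a)) phi =
  pexp o (fun a' => phi (Some (chosen a'))) a.
Proof.
elim: o s a => [|e o IH] s a rep /= uo osub.
  have -> : [set e in [::]] = set0 :> {set {set V}} by apply/setP=> f; rewrite !inE.
  by rewrite powerset0 big_set1 big_set0 mul1r expect_dret.
have [eo {}uo] := andP uo.
have eE : e \in edges adj by apply: osub; rewrite inE eqxx.
have {}osub : {subset o <= edges adj}.
  by move=> f fo; apply: osub; rewrite inE fo orbT.
have -> : [set f in e :: o] = e |: [set f in o] by apply/setP=> f; rewrite !inE.
set A := [set f in o].
have eA : e \notin A by rewrite inE.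
rewrite sum_powerset_setU1 //.
pose w (B : {set {set V}}) := \prod_(f in A) (if f \in B then x f else 1 - x f).
pose G b s' sel B := w B * wp 40 ([:: arrive], reveal adj e b s') (fun g =>
  expect (if g.1 is [::] then serve adj scheme 40 B o g.2
          (if nmem g.2 0 4 == 0%N then sel else e |: sel)
      else dret R None) phi).
have -> : \sum_(B in powerset A) \prod_(f in e |: A)
    (if f \in e |: B then x f else 1 - x f) *
    expect (serve adj scheme 40 (e |: B) (e :: o) s (chosen a)) phi =
    x e * \sum_(B in powerset A) G true s (chosen a) B.
  rewrite mulr_sumr; apply: eq_bigr => B BA.
  rewrite serve_cons big_setU1 //= !inE eqxx /= -mulrA; congr (_ * (_ * _)).
    apply: eq_bigr => f fA; rewrite !inE; case: eqVneq => // fe.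
    by rewrite -fe fA in eA.
  apply: eq_bigr => -[p [[|c k] s']] _ //=; congr (_ * _).
  apply: eq_serve => f fo; rewrite !inE; case: eqVneq => // fe.
  by rewrite -fe fo in eo.
have -> : \sum_(B in powerset A) \prod_(f in e |: A)
    (if f \in B then x f else 1 - x f) *
    expect (serve adj scheme 40 B (e :: o) s (chosen a)) phi =
    (1 - x e) * \sum_(B in powerset A) G false s (chosen a) B.
  rewrite mulr_sumr; apply: eq_bigr => B; rewrite inE => BA.
  have eB : (e \in B) = false.
    by apply: contraNF eA => /(subsetP BA).
  by rewrite serve_cons big_setU1 //= eB -mulrA.
have GE b : \sum_(B in powerset A) G b s (chosen a) B =
    let q := if available (chosen a) e && b then accept (surv a) e else 0 in
    q * pexp o (fun a' => phi (Some (chosen a'))) (pnext a e true) +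
    (1 - q) * pexp o (fun a' => phi (Some (chosen a'))) (pnext a e false).
  have [s1 [s0 [W sim1 rep0 dec0]]] := wp_arrive b rep eE.
  rewrite /G; under eq_bigr => B _ do rewrite W mulrDr ![w B * (_ * _)]mulrCA /=.
  rewrite big_split -!mulr_sumr /=; congr (_ + _ * _); last first.
    by rewrite dec0 eqxx -(IH s0).
  case: ifP => [av|_]; last by rewrite !mul0r.
  by have [rep1 dec1] := sim1 av; rewrite dec1 /= -(IH s1).
(* An inactive edge is never selected, so averaging over the state turns [accept] into x_e times
   [accept], which is [rate]. *)
rewrite !GE andbF andbT /pstep /prate /rate /=.
case: ifP => _; ring.
Qed.

Lemma select_prob_pexp order e : arrival_order adj order ->
  select_prob adj x scheme 40 order e =
  pexp order (fun a => (e \in chosen a)%:R) pstart.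
Proof.
move=> perm_o.
have memo : order =i edges adj by move=> f; rewrite (perm_mem perm_o) mem_enum.
have ordE : {subset order <= edges adj} by move=> f; rewrite memo.
have uo : uniq order by rewrite (perm_uniq perm_o) enum_uniq.
rewrite -[RHS](expect_serve (a := pstart) (fun m => (selects e m)%:R)
  represents_input uo ordE).
have -> : [set f in order] = edges adj by apply/setP=> f; rewrite inE memo.
by apply: eq_bigr => act _; rewrite prob_expect run_scheme.
Qed.

End Simulation.

(** * The constant alpha *)

Section Alpha.

Variable R : rcfType.

(** This is what singles out alpha: each F(v) is at least about 1 - alpha, and the ratio alpha /
    (F(u) F(v)) stays below 1 when the product is at least alpha. *)
Lemma alpha_fixpoint : (1 - alpha R) ^+ 2 = alpha R.
Proof.
have : Num.sqrt (5 : R) ^+ 2 = 5 by rewrite sqr_sqrtr.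
by rewrite /alpha !expr2; move: (Num.sqrt 5) => r; lra.
Qed.

Lemma alpha_bounds : 0 < alpha R < 1.
Proof.
have r1 : 1 < Num.sqrt (5 : R) by rewrite -[X in X < _]sqrtr1 ltr_sqrt // ltr1n.
have r3 : Num.sqrt (5 : R) < 3.
  have -> : (3 : R) = Num.sqrt (3 ^+ 2) by rewrite sqrtr_sqr ger0_norm.
  by rewrite ltr_sqrt expr2; lra.
by rewrite /alpha; apply/andP; split; lra.
Qed.

End Alpha.

(** * Linearity, bounds and martingales of the process *)

Section Process.

Variables (R : rcfType) (V : finType) (x : {set V} -> R).
Implicit Types (a : pstate R V) (phi psi : pstate R V -> R) (o : seq {set V}).

Lemma pexpD o phi psi a :
  pexp x o (fun a => phi a + psi a) a = pexp x o phi a + pexp x o psi a.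
Proof. by elim: o a => [|e o IH] a //=; rewrite /pstep !IH; ring. Qed.

Lemma pexpZ o c phi a : pexp x o (fun a => c * phi a) a = c * pexp x o phi a.
Proof. by elim: o a => [|e o IH] a //=; rewrite /pstep !IH; ring. Qed.

Lemma pexp_cst o c a : pexp x o (fun=> c) a = c.
Proof. by elim: o a => [|e o IH] a //=; rewrite /pstep !IH; ring. Qed.

Lemma accept_bounds (F : V -> R) e : 0 <= accept F e <= 1.
Proof. exact: clamp_bounds. Qed.

Lemma prate_ge0 a e : 0 <= x e -> 0 <= prate x a e.
Proof.
move=> xe; rewrite /prate /rate; case: ifP => // _; rewrite mulr_ge0 //.
by have /andP[] := accept_bounds (surv a) e.
Qed.

Lemma prate_le a e : 0 <= x e -> prate x a e <= x e.
Proof.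
move=> xe; rewrite /prate /rate; case: ifP => // _; rewrite ler_piMr //.
by have /andP[] := accept_bounds (surv a) e.
Qed.

Lemma pexp_ge0 o phi a : {in o, forall e, 0 <= x e <= 1} ->
  (forall a, 0 <= phi a) -> 0 <= pexp x o phi a.
Proof.
move=> xo phi0; elim: o xo a => [|e o IH] xo a //=.
have /andP[x0 x1] := xo e (mem_head _ _).
have {}IH := IH (fun f fo => xo f (mem_behead (s := e :: o) fo)).
rewrite addr_ge0 ?mulr_ge0 ?prate_ge0 //.
by rewrite subr_ge0 (le_trans (prate_le _ x0)).
Qed.

(* The density of v gets multiplied by a factor of conditional mean 1 as soon
   as prate x a e is the conditional probability of selecting e. *)
Lemma dens_next a e b v : dens (pnext x a e b) v =
  dens a v * (if v \in e then (if b then 0 else (1 - prate x a e)^-1) else 1).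
Proof.
rewrite /dens /= /decayed; case: b.
  rewrite cover_setU1 inE; case: (v \in e) => /=; first by rewrite mulr0.
  by rewrite mulr1.
by case: ifP => _; case: ifP => _; rewrite ?mul0r ?mulr1 ?invfM.
Qed.

(** At an endpoint of e, the density is divided by 1 - P(e) with probability 1 - P(e), and drops to
    0 otherwise. *)
Lemma pstep_dens a e v : prate x a e < 1 ->
  pstep x e (fun a => dens a v) a = dens a v.
Proof.
move=> r1; rewrite /pstep !dens_next; case: (v \in e); last by ring.
by rewrite mulr0 mulr0 add0r mulrCA divff ?mulr1 // subr_eq0 gt_eqF.
Qed.

(** When both vertices lie on e, two factors 1 / (1 - P(e)) meet a single probability 1 - P(e), so
    one of them survives. *)
Lemma pstep_dens2 a e u v : prate x a e < 1 ->
  pstep x e (fun a => dens a u * dens a v) a = dens a u * dens a v *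
    (if (u \in e) && (v \in e) then (1 - prate x a e)^-1 else 1).
Proof.
move=> r1; have rn : 1 - prate x a e != 0 by rewrite subr_eq0 gt_eqF.
rewrite /pstep !dens_next.
by case: (u \in e); case: (v \in e) => /=; field.
Qed.

(** Selections are irrevocable, so the indicator can only grow along the process. *)
Lemma le_pexp_chosen o e a : {in o, forall f, 0 <= x f <= 1} ->
  (e \in chosen a)%:R <= pexp x o (fun a => (e \in chosen a)%:R) a.
Proof.
elim: o a => [|f o IH] a xo //=.
have /andP[x0 x1] := xo f (mem_head _ _).
have {}IH a' := IH a' (fun f' fo => xo f' (mem_behead (s := f :: o) fo)).
have mono b : (e \in chosen a)%:R <= pexp x o (fun a => (e \in chosen a)%:R)
    (pnext x a f b).
  apply: le_trans (IH _); rewrite ler_nat /=; case: b => //.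
  by rewrite inE; case: (e \in chosen a); rewrite ?orbT.
have r0 := prate_ge0 a x0; have := prate_le a x0.
rewrite /pstep; have := mono true; have := mono false; nra.
Qed.

Lemma prate_le_pexp_chosen o e a : {in e :: o, forall f, 0 <= x f <= 1} ->
  prate x a e <= pexp x (e :: o) (fun a => (e \in chosen a)%:R) a.
Proof.
move=> xo; have /andP[x0 x1] := xo e (mem_head _ _).
have {}xo : {in o, forall f, 0 <= x f <= 1}.
  by move=> f fo; apply: xo; rewrite inE fo orbT.
have r0 := prate_ge0 a x0; have rx := prate_le a x0.
have c1 := le_pexp_chosen e (pnext x a e true) xo.
have c0 : 0 <= pexp x o (fun a => (e \in chosen a)%:R) (pnext x a e false).
  by apply: pexp_ge0.
move: c1; rewrite /= setU11 /= => /(ler_wpM2l r0); rewrite mulr1 /pstep => c1.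
by apply: (le_trans c1); rewrite lerDl mulr_ge0 // subr_ge0 (le_trans rx).
Qed.

End Process.

(** * Quantitative analysis when all weights are at most eps *)

Section Analysis.

Variables (R : realType) (V : finType) (x : {set V} -> R) (eps : R).
Hypothesis eps_bounds : 0 <= eps <= 1 / 2.
Implicit Types (a : pstate R V) (phi psi : pstate R V -> R) (o : seq {set V}).

Definition load o (v : V) : R := \sum_(e <- o | v \in e) x e.

Definition pair_set (e : {set V}) : Prop := exists u w, u != w /\ e = [set u; w].

(** All four clauses pass to prefixes, as the inductions on the last edge require. *)
Definition good o : Prop :=
  [/\ uniq o, {in o, forall e, pair_set e}, {in o, forall e, 0 <= x e <= eps} &
      forall v, load o v <= 1].

Lemma load_rcons o e v :
  load (rcons o e) v = load o v + (if v \in e then x e else 0).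
Proof.
rewrite /load -cats1 big_cat /= big_cons big_nil.
by case: ifP; rewrite ?addr0.
Qed.

Lemma good_cat o1 o2 : good (o1 ++ o2) -> good o1.
Proof.
move=> [uo eo xo lo]; split.
- by move: uo; rewrite cat_uniq => /and3P[].
- by move=> e eo1; apply: eo; rewrite mem_cat eo1.
- by move=> e eo1; apply: xo; rewrite mem_cat eo1.
move=> v; apply: le_trans (lo v); rewrite /load big_cat /= lerDl big_seq_cond.
apply: sumr_ge0 => e /andP[eo2 _].
by have /andP[] : 0 <= x e <= eps by apply: xo; rewrite mem_cat eo2 orbT.
Qed.

Lemma good_rcons o e : good (rcons o e) ->
  [/\ good o, e \notin o, pair_set e & 0 <= x e <= eps].
Proof.
rewrite -cats1 => g; split; first exact: good_cat g.
- by case: g; rewrite cats1 rcons_uniq => /andP[].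
- by case: g => _ eo _ _; apply: eo; rewrite mem_cat mem_head orbT.
- by case: g => _ _ xo _; apply: xo; rewrite mem_cat mem_head orbT.
Qed.

Lemma pair_set_at e v : pair_set e -> v \in e ->
  exists2 w, v != w & e = [set v; w].
Proof.
move=> [u [w [uw ->]]]; rewrite !inE => /orP[]/eqP->; first by exists w.
by exists u; rewrite 1?eq_sym // setUC.
Qed.

Lemma pair_set_eq e u v : pair_set e -> u != v -> u \in e -> v \in e ->
  e = [set u; v].
Proof.
move=> pe uv ue ve; have [w uw eE] := pair_set_at pe ue.
by move: ve; rewrite eE !inE eq_sym (negbTE uv) /= => /eqP->.
Qed.

(** Pathwise invariants. The first keeps F away from 0 and so bounds M_v by exp 2; the second is
    F(v) >= 1 - alpha sum_e x_e M_u with x_e M_u split as x_e (M_u - 1) + x_e. *)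
Definition sound o a : Prop := forall v,
  expR (- (2 * load o v)) <= surv a v /\
  1 <= surv a v + alpha R * drift a v + alpha R * load o v.

Lemma dens_ge0 o a v : sound o a -> 0 <= dens a v.
Proof.
move=> /(_ v)[lb _]; rewrite /dens; case: ifP => // _.
by rewrite invr_ge0; apply: le_trans lb; apply: expR_ge0.
Qed.

Lemma sound_surv o a v : sound o a -> 0 < surv a v.
Proof. by move=> /(_ v)[lb _]; apply: lt_le_trans lb; apply: expR_gt0. Qed.

Lemma dens_le o a v : good o -> sound o a -> dens a v <= expR 2.
Proof.
move=> [_ _ _ lo] sa; have F0 := sound_surv v sa; rewrite /dens.
case: ifP => _; first exact: expR_ge0.
rewrite -[X in _ <= X]invrK -expRN lef_pV2 ?posrE ?expR_gt0 //.
have [lb _] := sa v; apply: le_trans lb; rewrite ler_expR lerN2.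
by have := lo v; lra.
Qed.

Lemma prod_pair (u w : V) (f : V -> R) : u != w ->
  \prod_(v in [set u; w]) f v = f u * f w.
Proof. by move=> uw; rewrite big_setU1 ?inE //= big_set1. Qed.

Lemma drift_next a u w b : u != w ->
  drift (pnext x a [set u; w] b) u =
  drift a u + x [set u; w] * (dens a w - 1).
Proof.
move=> uw; rewrite /= !inE eqxx /=; congr (_ + _ * (_ - _)).
by rewrite setU1K ?inE // big_set1.
Qed.

Lemma accept_pair (F : V -> R) u w : u != w -> 0 < F u -> 0 < F w ->
  accept F [set u; w] = Num.min 1 (alpha R / (F u * F w)).
Proof.
move=> uw Fu Fw; rewrite /accept /clamp prod_pair // max_r //.
have /andP[a0 _] := alpha_bounds R.
by apply: ltW; apply: divr_gt0 => //; apply: mulr_gt0.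
Qed.

Lemma sound_start : sound [::] (pstart R V).
Proof. by move=> v; rewrite /load big_nil !mulr0 !addr0 oppr0 expR0. Qed.

Lemma sound_next o e a b : good (rcons o e) -> sound o a ->
  sound (rcons o e) (pnext x a e b).
Proof.
move=> /good_rcons[go _ pe /andP[x0 xeps]] sa v; rewrite load_rcons.
have [lb ub] := sa v.
case: (boolP (v \in e)) => ve; last by rewrite /= /decayed (negbTE ve) !addr0.
have [w vw eE] := pair_set_at pe ve.
have r0 := prate_ge0 a x0; have rx := prate_le a x0.
have /andP[e0 e2] := eps_bounds.
have Fv := sound_surv v sa; have Fw := sound_surv w sa.
split.
  rewrite /= /decayed ve mulrDr opprD expRD; apply: ler_pM => //.
  - exact: expR_ge0.
  - exact: expR_ge0.
  (* For 0 <= x <= 1/2 one has 1 / (1 - x) <= 1 + 2 x <= exp (2 x); this is where eps <= 1/2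
     enters. *)
  rewrite expRN; apply: (@le_trans _ _ (1 - x e)); last by lra.
  rewrite -[X in _ <= X]invrK lef_pV2 ?posrE ?expR_gt0 ?invr_gt0 //; last by lra.
  apply: le_trans (expR_ge1Dx _).
  have xlt : 0 < 1 - x e by lra.
  rewrite -[X in X <= _]mul1r ler_pdivrMr //; nra.
have -> : drift (pnext x a e b) v = drift a v + x e * (dens a w - 1).
  by rewrite eE drift_next.
rewrite /= /decayed ve.
have al := alpha_bounds R; have Mw := dens_ge0 w sa.
(* F(v) loses F(v) P(e), while drift and load together gain x_e M_w. *)
suff : surv a v * prate x a e <= alpha R * x e * dens a w by nra.
rewrite /prate /rate; case: ifP => av; last first.
  by rewrite mulr0; do 2 apply: mulr_ge0 => //; case/andP: al => /ltW.
have wfree : w \notin cover (chosen a).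
  move: av; rewrite /available eE disjoints_subset subUset !sub1set !inE.
  by case/andP.
rewrite /dens (negbTE wfree) [in accept _ _]eE accept_pair //.
(* Bounding the minimum by its second entry makes F(v) cancel. *)
apply: (@le_trans _ _ (surv a v * (x e * (alpha R / (surv a v * surv a w))))).
  apply: ler_wpM2l; first exact: ltW.
  by apply: ler_wpM2l => //; rewrite ge_min lexx orbT.
by rewrite le_eqVlt; apply/orP; left; apply/eqP; field; rewrite !gt_eqF.
Qed.

(** Brings pathwise bounds under the expectation: peeling off the last edge lets soundness propagate
    forward from the start. *)
Lemma le_pexp o phi psi : good o ->
  (forall a, sound o a -> phi a <= psi a) ->
  pexp x o phi (pstart R V) <= pexp x o psi (pstart R V).
Proof.
elim/last_ind: o phi psi => [|o e IH] phi psi go le_phi.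
  exact: le_phi sound_start.
rewrite !pexp_rcons; have [go' _ _ /andP[x0 xe]] := good_rcons go.
have /andP[e0 e2] := eps_bounds.
apply: IH => // a sa; apply: lerD; apply: ler_wpM2l.
- exact: prate_ge0.
- by apply: le_phi; apply: sound_next.
- by rewrite subr_ge0 (le_trans (prate_le _ x0)) //; lra.
- by apply: le_phi; apply: sound_next.
Qed.

Local Notation E o phi := (pexp x o phi (pstart R V)).

Lemma prate_lt1 a e : 0 <= x e <= eps -> prate x a e < 1.
Proof.
move=> /andP[x0 xe]; apply: le_lt_trans (prate_le a x0) _.
by case/andP: eps_bounds; lra.
Qed.

Lemma dens_start v : dens (pstart R V) v = 1.
Proof. by rewrite /dens /= /cover big_set0 inE invr1. Qed.

Lemma pexp_dens o v : good o -> E o (fun a => dens a v) = 1.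
Proof.
elim/last_ind: o => [|o e IH] go; first exact: dens_start.
have [go' _ _ xe] := good_rcons go.
rewrite pexp_rcons -(IH go'); apply: eq_pexp => a.
exact/pstep_dens/prate_lt1.
Qed.

Lemma pexp_dens2 o u v : good o ->
  {in o, forall e : {set V}, ~~ ((u \in e) && (v \in e))} ->
  E o (fun a => dens a u * dens a v) = 1.
Proof.
elim/last_ind: o => [|o e IH] go uvo; first by rewrite /= !dens_start mulr1.
have [go' _ _ xe] := good_rcons go.
rewrite pexp_rcons -(IH go'); last first.
  by move=> f fo; apply: uvo; rewrite mem_rcons inE fo orbT.
apply: eq_pexp => a; rewrite pstep_dens2 ?prate_lt1 // (negbTE (uvo e _)) ?mulr1 //.
by rewrite mem_rcons mem_head.
Qed.

(** In a simple graph only one edge joins u and v, and it arrives once. *)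
Lemma pair_notin o e u v : good (rcons o e) -> u != v -> u \in e -> v \in e ->
  {in o, forall f : {set V}, ~~ ((u \in f) && (v \in f))}.
Proof.
move=> go uv ue ve f fo; apply/negP => /andP[uf vf].
have [[_ po _ _] eo pe _] := good_rcons go.
by rewrite (pair_set_eq pe uv ue ve) -(pair_set_eq (po f fo) uv uf vf) fo in eo.
Qed.

(** The mean is exactly 1 until the edge {u, v} arrives, is multiplied by at most 1 / (1 - eps) <= 1
    + 2 eps there, and stays constant afterwards; the error does not accumulate. *)
Lemma pexp_dens2_le o u v : good o -> u != v ->
  E o (fun a => dens a u * dens a v) <= 1 + 2 * eps.
Proof.
have /andP[e0 e2] := eps_bounds.
elim/last_ind: o => [|o e IH] go uv; first by rewrite /= !dens_start; lra.
have [go' _ _ xe] := good_rcons go; rewrite pexp_rcons.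
case: (boolP ((u \in e) && (v \in e))) => uve; last first.
  apply: le_trans (IH go' uv); apply: le_pexp => // a sa.
  by rewrite pstep_dens2 ?prate_lt1 // (negbTE uve) mulr1.
have /andP[ue ve] := uve.
apply: (@le_trans _ _ ((1 + 2 * eps) * E o (fun a => dens a u * dens a v)));
  last by rewrite (pexp_dens2 go' (pair_notin go uv ue ve)) mulr1.
rewrite -pexpZ.
apply: le_pexp => // a sa; have r1 := prate_lt1 a xe.
rewrite pstep_dens2 // uve [X in _ <= X]mulrC; apply: ler_wpM2l.
  by apply: mulr_ge0; apply: dens_ge0 sa.
have /andP[x0 xeps] := xe; have := prate_le a x0 => rx.
have r0 := prate_ge0 a x0.
rewrite -[X in X <= _]mul1r ler_pdivrMr ?subr_gt0 //.
have : 0 <= prate x a e * (1 - 2 * eps) by rewrite mulr_ge0 //; lra.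
lra.
Qed.

Lemma pexp_cov o u v : good o -> u != v ->
  E o (fun a => (dens a u - 1) * (dens a v - 1)) <= 2 * eps.
Proof.
move=> go uv.
have -> : E o (fun a => (dens a u - 1) * (dens a v - 1)) =
    E o (fun a => dens a u * dens a v + (-1 * dens a u + (-1 * dens a v + 1))).
  by apply: eq_pexp => a; ring.
rewrite !pexpD !pexpZ pexp_cst !pexp_dens //.
by have := pexp_dens2_le go uv; lra.
Qed.

Lemma load_ge0 o v : good o -> 0 <= load o v.
Proof.
move=> [_ _ xo _]; rewrite /load big_seq_cond; apply: sumr_ge0 => e /andP[eo _].
by case/andP: (xo e eo).
Qed.

(** The update of the drift does not depend on the outcome, so it factors out and only the
    martingale M_w is averaged. *)
Lemma pstep_drift_dens a e u w : 0 <= x e <= eps ->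
  pstep x e (fun a => drift a u * (dens a w - 1)) a =
  drift (pnext x a e false) u * (dens a w - 1).
Proof.
move=> xe; rewrite -[in RHS](pstep_dens w (prate_lt1 a xe)) /pstep.
have -> : drift (pnext x a e true) u = drift (pnext x a e false) u by [].
ring.
Qed.

(** D(u) sums terms x_e (M_y - 1) frozen at the arrival of e = {u, y}. By the martingale property of
    M_w each contributes x_e times a covariance at that time, and y differs from w because {u, w}
    has not arrived. *)
Lemma pexp_drift_dens o u w : good o -> u != w ->
  {in o, forall e : {set V}, ~~ ((u \in e) && (w \in e))} ->
  E o (fun a => drift a u * (dens a w - 1)) <= 2 * eps * load o u.
Proof.
elim/last_ind: o => [|o e IH] go uw uwo.
  by rewrite /= mul0r /load big_nil mulr0.
have [go' _ pe xe] := good_rcons go; have /andP[x0 xeps] := xe.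
have {}IH := IH go' uw.
rewrite pexp_rcons load_rcons.
have {}IH : E o (fun a => drift a u * (dens a w - 1)) <= 2 * eps * load o u.
  by apply: IH => f fo; apply: uwo; rewrite mem_rcons inE fo orbT.
rewrite (eq_pexp _ _ (psi := fun a => drift (pnext x a e false) u * (dens a w - 1)));
  last by move=> a; rewrite pstep_drift_dens.
case: (boolP (u \in e)) => ue; last first.
  rewrite addr0; apply: le_trans IH; apply: le_pexp => // a sa.
  by rewrite /= (negbTE ue).
have [y uy eE] := pair_set_at pe ue.
have yw : y != w.
  have := uwo e; rewrite mem_rcons mem_head => /(_ isT).
  by rewrite ue /=; apply: contra => /eqP <-; rewrite eE !inE eqxx orbT.
rewrite (eq_pexp _ _ (psi := fun a => drift a u * (dens a w - 1) +
  x e * ((dens a y - 1) * (dens a w - 1)))); last first.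
  by move=> a; rewrite eE drift_next // -eE; ring.
rewrite pexpD pexpZ mulrDr; apply: lerD => //.
by rewrite [X in _ <= X]mulrC; apply: ler_wpM2l => //; apply: pexp_cov.
Qed.

Definition drift_constant : R := 4 + expR 2 ^+ 2.

(** The increment of D(u)^2 has a cross term 2 x_e D(u) (M_y - 1), of mean at most 4 eps x_e, and a
    square x_e^2 (M_y - 1)^2, at most eps x_e exp(2)^2; these are the two summands of
    [drift_constant]. *)
Lemma pexp_drift_sqr o u : good o ->
  E o (fun a => drift a u ^+ 2) <= drift_constant * eps * load o u.
Proof.
have /andP[e0 e2] := eps_bounds.
elim/last_ind: o => [|o e IH] go.
  by rewrite /= expr0n /load big_nil mulr0.
have [go' _ pe xe] := good_rcons go; have /andP[x0 xeps] := xe.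
have {}IH := IH go'.
rewrite pexp_rcons load_rcons.
rewrite (eq_pexp _ _ (psi := fun a => drift (pnext x a e false) u ^+ 2)); last first.
  move=> a; rewrite /pstep.
  have -> : drift (pnext x a e true) u = drift (pnext x a e false) u by [].
  ring.
case: (boolP (u \in e)) => ue; last first.
  rewrite addr0; apply: le_trans IH; apply: le_pexp => // a sa.
  by rewrite /= (negbTE ue).
have [y uy eE] := pair_set_at pe ue.
apply: (@le_trans _ _ (E o (fun a => drift a u ^+ 2 +
    (2 * x e * (drift a u * (dens a y - 1)) + x e * eps * expR 2 ^+ 2)))).
  apply: le_pexp => // a sa; rewrite eE drift_next // -eE sqrrD -addrA.
  apply: lerD => //; apply: lerD.
    by rewrite le_eqVlt; apply/orP; left; apply/eqP; ring.
  rewrite exprMn; apply: ler_pM; rewrite ?sqr_ge0 //.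
    by rewrite expr2; apply: ler_wpM2l.
  have M0 := dens_ge0 y sa; have MB := dens_le y go' sa.
  have B1 : 1 <= expR (2 : R) by have := expR_ge1Dx (2 : R); lra.
  rewrite -ler_sqrt ?sqr_ge0 // !sqrtr_sqr [X in _ <= X]ger0_norm ?expR_ge0 //.
  by rewrite ler_norml; apply/andP; split; lra.
rewrite !pexpD pexpZ pexp_cst mulrDr; apply: lerD => //.
have ye : y \in e by rewrite eE !inE eqxx orbT.
have := pexp_drift_dens go' uy (pair_notin go uy ue ye).
have [_ _ _ /(_ u) l1] := go'; have l0 := load_ge0 u go'.
rewrite /drift_constant; move: (E _ _) => z zle.
have : 2 * eps * load o u <= 2 * eps by rewrite ler_piMr // mulr_ge0.
move=> le2.
have : 2 * x e * z <= 2 * x e * (2 * eps).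
  by apply: ler_wpM2l; [rewrite mulr_ge0|apply: le_trans le2].
move: (expR 2 ^+ 2) => B; nra.
Qed.

Lemma surv_mul_ge (b p q t t' : R) : 0 < b < 1 -> 0 < p -> 0 < q ->
  b - t <= p -> b - t' <= q -> 0 <= t -> 0 <= t' -> b ^+ 2 - t - t' <= p * q.
Proof.
move=> /andP[b0 b1] p0 q0 pt qt t0 t'0.
have pq : 0 < p * q by rewrite mulr_gt0.
have bb : b ^+ 2 <= b by rewrite expr2 ler_piMr // ltW.
(* A nonpositive factor b - t cannot be multiplied through, but then b^2 - t <= 0 already. *)
have [bt|tb] := leP b t; first by lra.
have [bt'|tb'] := leP b t'; first by lra.
have : (b - t) * (b - t') <= p * q by apply: ler_pM => //; lra.
have : b * (t + t') <= t + t' by rewrite ler_piMl ?addr_ge0 // ltW.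
have : 0 <= t * t' by rewrite mulr_ge0.
rewrite expr2; lra.
Qed.

(** The right side is min(f, al) / f, and min(f, al) >= al - t. It is used with f = F(u) F(w), whose
    inverse is M_u M_w. *)
Lemma min_ratio_ge (B al f t : R) : 0 < al -> 0 < f -> f^-1 <= B -> 0 <= t ->
  al - t <= f -> al * f^-1 - B * t <= Num.min 1 (al / f).
Proof.
move=> al0 f0 fB t0 alt; rewrite le_min; apply/andP; split; last first.
  by rewrite gerBl mulr_ge0 // (le_trans _ fB) // invr_ge0 ltW.
rewrite lerBlDr; apply: (@le_trans _ _ (1 + f^-1 * t)); last first.
  by rewrite lerD2l ler_wpM2r.
rewrite ler_pdivrMr // mulrDl mul1r mulrAC mulVf ?gt_eqF // mul1r; lra.
Qed.

Definition acceptance_prob a e : R :=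
  if available (chosen a) e then accept (surv a) e else 0.

Definition slack (s d : R) : R := (d ^+ 2 / s + s) / 2.

(* AM-GM: slack s d is a quadratic upper bound for d. *)
Lemma slack_ge (s d : R) : 0 < s -> 0 <= slack s d /\ d <= slack s d.
Proof.
move=> s0; rewrite /slack; split.
  by rewrite divr_ge0 // addr_ge0 ?divr_ge0 ?sqr_ge0 // ltW.
rewrite -subr_ge0.
have -> : (d ^+ 2 / s + s) / 2 - d = (d - s) ^+ 2 / (2 * s).
  by field; rewrite gt_eqF.
by rewrite divr_ge0 ?sqr_ge0 // mulr_ge0 // ltW.
Qed.

(** If an endpoint is taken, M_u M_w = 0 and the left side is nonpositive. Otherwise F >= 1 - alpha
    - slack at both ends, and [alpha_fixpoint] turns the product into alpha minus the slacks. *)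
Lemma acceptance_prob_ge o a u w s : good o -> sound o a -> u != w -> 0 < s ->
  alpha R * (dens a u * dens a w)
    - expR 2 ^+ 2 * (slack s (drift a u) + slack s (drift a w))
  <= acceptance_prob a [set u; w].
Proof.
move=> go sa uw s0; have := alpha_bounds R => /andP[al0 al1].
have [tu0 tu] := slack_ge (drift a u) s0; have [tw0 tw] := slack_ge (drift a w) s0.
rewrite /acceptance_prob.
have -> : available (chosen a) [set u; w] =
    (u \notin cover (chosen a)) && (w \notin cover (chosen a)).
  by rewrite /available disjoints_subset subUset !sub1set !inE.
have B0 : 0 <= expR 2 ^+ 2 * (slack s (drift a u) + slack s (drift a w)).
  by rewrite mulr_ge0 ?sqr_ge0 // addr_ge0.
have Mu := dens_le u go sa; have Mw := dens_le w go sa.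
have Mu0 := dens_ge0 u sa; have Mw0 := dens_ge0 w sa.
have Fu := sound_surv u sa; have Fw := sound_surv w sa.
have low v : 0 <= slack s (drift a v) -> drift a v <= slack s (drift a v) ->
    (1 - alpha R) - slack s (drift a v) <= surv a v.
  move=> t0 t1; have [_ lb] := sa v; have [_ _ _ /(_ v) l1] := go.
  have : alpha R * drift a v <= alpha R * slack s (drift a v).
    by rewrite ler_wpM2l // ltW.
  have : alpha R * slack s (drift a v) <= slack s (drift a v).
    by rewrite ler_piMl // ltW.
  have : alpha R * load o v <= alpha R by rewrite ler_piMr // ltW.
  lra.
have MM : dens a u * dens a w <= expR 2 ^+ 2 by rewrite expr2 ler_pM.
move: MM; rewrite /dens; case: (u \in cover _) => /=.
  by rewrite mul0r mulr0 sub0r oppr_le0.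
case: (w \in cover _) => /=; first by rewrite !mulr0 sub0r oppr_le0.
rewrite -invfM accept_pair // => MM.
apply: min_ratio_ge => //; [exact: mulr_gt0 | exact: addr_ge0 |].
have b01 : 0 < 1 - alpha R < 1 by apply/andP; split; lra.
have := surv_mul_ge b01 Fu Fw (low u tu0 tu) (low w tw0 tw) tu0 tw0.
by rewrite alpha_fixpoint; lra.
Qed.

Definition loss_constant : R := expR 2 ^+ 2 * (drift_constant + 1).

Lemma pexp_acceptance o e : good (rcons o e) -> 0 < eps ->
  alpha R - loss_constant * Num.sqrt eps <= E o (fun a => acceptance_prob a e).
Proof.
move=> go e0; have [go' _ [u [w [uw eE]]] _] := good_rcons go.
(* This s balances the two parts of [slack]: the mean of D^2 / s is O(eps / s), against s itself. *)
pose s := Num.sqrt eps; have s0 : 0 < s by rewrite sqrtr_gt0.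
have ss : eps = s * s by rewrite -expr2 sqr_sqrtr // ltW.
(* The coefficient of each squared drift in the bound of [acceptance_prob_ge]. *)
pose c := - (expR 2 ^+ 2 / (2 * s)).
apply: (@le_trans _ _ (E o (fun a => alpha R * (dens a u * dens a w) +
   (c * drift a u ^+ 2 + (c * drift a w ^+ 2 + - (expR 2 ^+ 2 * s)))))); last first.
  apply: le_pexp => // a sa.
  rewrite eE; apply: le_trans (acceptance_prob_ge go' sa uw s0).
  rewrite le_eqVlt; apply/orP; left; apply/eqP; rewrite /slack /c; field.
  by rewrite gt_eqF.
have uve : {in o, forall f : {set V}, ~~ ((u \in f) && (w \in f))}.
  by apply: (pair_notin go uw); rewrite eE !inE eqxx ?orbT.
rewrite !pexpD !pexpZ pexp_cst pexp_dens2 // mulr1.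
have K0 : 0 <= drift_constant * eps.
  by rewrite mulr_ge0 ?ltW // /drift_constant addr_gt0 // exprn_gt0 // expR_gt0.
have bound v : c * (drift_constant * eps) <= c * E o (fun a => drift a v ^+ 2).
  apply: ler_wnM2l.
    by rewrite oppr_le0 divr_ge0 ?sqr_ge0 // mulr_ge0 // ltW.
  apply: le_trans (pexp_drift_sqr v go') _; rewrite ler_piMr //.
  by have [_ _ _] := go'.
have cK : c * (drift_constant * eps) = - (expR 2 ^+ 2 * drift_constant * s) / 2.
  by rewrite ss /c; field; rewrite gt_eqF.
have := bound u; have := bound w; rewrite cK /loss_constant -/s.
lra.
Qed.

Lemma pexp_chosen_ge o1 e o2 : good (o1 ++ e :: o2) ->
  (alpha R - loss_constant * Num.sqrt eps) * x e <=
  E (o1 ++ e :: o2) (fun a => (e \in chosen a)%:R).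
Proof.
move=> go; have /andP[e0 e2] := eps_bounds.
have xo : {in o1 ++ e :: o2, forall f, 0 <= x f <= 1}.
  move=> f fo; have [_ _ /(_ f fo)/andP[-> xf] _] := go.
  by apply: le_trans xf _; lra.
have go1 : good (rcons o1 e) by apply: (@good_cat _ o2); rewrite cat_rcons.
have [go1' _ _ /andP[x0 xe]] := good_rcons go1.
(* With eps = 0 the choice s = sqrt eps would divide by 0; then x_e = 0 and the claim is trivial. *)
have [eps0|eps0] := leP eps 0.
  have -> : x e = 0 by apply/le_anti; rewrite x0 (le_trans xe).
  rewrite mulr0; apply: pexp_ge0 => // a; exact: ler0n.
rewrite mulrC pexp_cat; apply: le_trans (ler_wpM2l x0 (pexp_acceptance go1 eps0)) _.
rewrite -pexpZ; apply: le_pexp => // a _.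
apply: le_trans (prate_le_pexp_chosen _ _); last first.
  by move=> f fo; apply: xo; rewrite mem_cat fo orbT.
by rewrite /prate /rate /acceptance_prob; case: ifP; rewrite ?mulr0.
Qed.

End Analysis.

(** * Assembly *)

Theorem theorem1 (R : realType) :
  exists (P : ocrs) (c k : nat) (f : R -> R),
    f eps @[eps --> (0 : R)^'] --> (0 : R) /\
    forall (V : finType) (adj : rel V) (x : {set V} -> R)
           (order : seq {set V}),
      symmetric adj -> irreflexive adj ->
      fractional_matching adj x ->
      arrival_order adj order ->
      let t := (c * (#|V| + #|edges adj|).+1 ^ k)%N in
      (forall act : {set {set V}}, act \subset edges adj ->
         prob (run adj x P t act order) (matching_of_active act) = 1) /\
      (forall e : {set V}, e \in edges adj ->
         (alpha R - f (max_weight adj x)) * x e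
           <= select_prob adj x P t order e).
Proof.
(* Every arrival takes constant time, hence the exponent 0. *)
exists scheme, 40, 0%N, (fun eps => loss_constant R * Num.sqrt `|eps|); split.
  apply: cvg_within_filter.
  have : loss_constant R * Num.sqrt `|eps| @[eps --> (0 : R)] -->
      loss_constant R * Num.sqrt `|0 : R|.
    apply: cvgMl_tmp; apply: continuous_cvg; first exact: sqrt_continuous.
    exact: norm_continuous.
  by rewrite normr0 sqrtr0 mulr0.
move=> V adj x order _ irr [x01 xv] perm_o t.
have -> : t = 40%N by rewrite /t expn0 muln1.
have memo : order =i edges adj by move=> f; rewrite (perm_mem perm_o) mem_enum.
split=> [act _|e eE]; first by apply: run_matching => // f; rewrite memo.
rewrite (select_prob_pexp x irr e perm_o).
set eps := max_weight adj x.
have eps0 : 0 <= eps by exact: bigmax_ge_id.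
have xeps f : f \in edges adj -> x f <= eps.
  by move=> fE; apply: (le_bigmax_cond _ x fE).
rewrite ger0_norm //.
have [eps2|eps2] := leP eps (1 / 2).
  have eo : e \in order by rewrite memo.
  have [o1 [o2 orderE]] : exists o1 o2, order = o1 ++ e :: o2.
    by case/splitPr: eo => o1 o2; exists o1, o2.
  rewrite orderE; apply: pexp_chosen_ge; rewrite ?eps0 // -orderE; split.
  - by rewrite (perm_uniq perm_o) enum_uniq.
  - by move=> f; rewrite memo; apply: edgeP.
  - by move=> f; rewrite memo => fE; case/andP: (x01 f fE) => -> _; apply: xeps.
  - by move=> v; rewrite /load (perm_big _ perm_o) big_enum_cond; apply: xv.
have xo : {in order, forall f, 0 <= x f <= 1}.
  by move=> f; rewrite memo; apply: x01.
(* For eps > 1/2 the guarantee is vacuous: the loss is at least 6 times 1/2, which exceeds alpha. *)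
apply: (@le_trans _ _ 0); last by apply: pexp_ge0 => // a; apply: ler0n.
have /andP[x0 _] := x01 e eE; rewrite mulr_le0_ge0 // subr_le0.
have /andP[_ al1] := alpha_bounds R.
have B1 : 1 <= expR (2 : R) by have := expR_ge1Dx (2 : R); lra.
have B2 : 1 <= expR (2 : R) ^+ 2 by rewrite exprn_ege1.
have C6 : 6 <= loss_constant R.
  by rewrite -[X in X <= _]mul1r ler_pM // /drift_constant; lra.
have s2 : 1 / 2 <= Num.sqrt eps.
  rewrite -[X in X <= _]ger0_norm -?sqrtr_sqr ?ler_sqrt ?expr2 //; lra.
have : 6 * (1 / 2) <= loss_constant R * Num.sqrt eps by rewrite ler_pM //; lra.
lra.
Qed.
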